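(* Let $\mathscr Z$ be a basis of $Z$, and let $b=\dim Z$. Then in $\bigwedge^bE$, $$\det\mathscr Z=\sum_{T\in\mathcal B(\mathcal M)}\det(\mathscr Z/\mathscr Z_T)\;e_{T^c}.$$
   Context: Let $\mathbb K=\mathbb R$ or $\mathbb C$, $S=\{1,\dots,s\}$, $E$ an $s$-dimensional $\mathbb K$-vector space with basis $(e_i)_{i\in S}$, $F$ a $\mathbb K$-vector space, and $\partial:E\to F$ a linear map. Let $\mathcal M$ be the linear matroid on $S$ whose independent sets are the $I\subseteq S$ such that $\{\partial(e_i):i\in I\}$ is linearly independent; $\mathcal B(\mathcal M)$ is its set of bases; $Z=\ker\partial$. For $J\subseteq S$, $E_J=\mathrm{Vect}(e_j:j\in J)$ and $J^c=S\setminus J$. For $T\in\mathcal B(\mathcal M)$ one has $E=E_T\oplus Z$; $\mathsf Z_T:E\to Z$ is the corresponding projection, and $\mathscr Z_T=(\mathsf Z_T(e_j):j\in T^c)$, ordered by the order of $S$, is a basis of $Z$. For an ordered basis $\mathscr B$ of a vector space, $\det\mathscr B$ is the exterior product of its elements; for two bases $\mathscr B_1,\mathscr B_2$ of the same space, $\det(\mathscr B_1/\mathscr B_2)$ is the determinant of the matrix of the vectors of $\mathscr B_1$ in $\mathscr B_2$, so that $\det\mathscr B_1=\det(\mathscr B_1/\mathscr B_2)\det\mathscr B_2$. For $J=\{i_1<\dots<i_r\}\subseteq S$, $e_J=e_{i_1}\wedge\dots\wedge e_{i_r}$. *)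

(* Defs.v *)
From HB Require Import structures.
From mathcomp Require Import all_boot all_order all_algebra.
From mathcomp Require Import generic_quotient ring_quotient freeg.
From mathcomp Require Import boolp reals complex.

Set Implicit Arguments.
Unset Strict Implicit.
Unset Printing Implicit Defensive.

Import GRing.Theory.
Local Open Scope ring_scope.
Local Open Scope quotient_scope.

(* Any two [realType]s are isomorphic, so [R] is the field of real numbers. *)
Variant real_or_complex (R : realType) : fieldType -> Prop :=
  | IsReal : real_or_complex R R
  | IsComplex : real_or_complex R R[i].

Section MultilinearMaps.
Variables (K : fieldType) (E : lmodType K) (k : nat).

Definition tupdate (v : k.-tuple E) (i : 'I_k) (x : E) : k.-tuple E :=
  [tuple if j == i then x else tnth v j | j < k].

Definition multilinear (W : lmodType K) (f : k.-tuple E -> W) : Prop :=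
  forall (v : k.-tuple E) (i : 'I_k) (a : K) (x y : E),
    f (tupdate v i (a *: x + y)) = a *: f (tupdate v i x) + f (tupdate v i y).

Definition alternating (W : lmodType K) (f : k.-tuple E -> W) : Prop :=
  forall (v : k.-tuple E) (i j : 'I_k),
    i != j -> tnth v i = tnth v j -> f v = 0.

(* The subspace spanned by the defining relations of the exterior power,
   inside the free vector space on [E ^ k]. *)
Inductive ext_rel : {freeg (k.-tuple E) / K} -> Prop :=
  | ExtRel0 : ext_rel 0
  | ExtRelP a x y : ext_rel x -> ext_rel y -> ext_rel (a *: x + y)
  | ExtRelLinear v i a x y :
      ext_rel (<< tupdate v i (a *: x + y) >>
               - (a *: << tupdate v i x >> + << tupdate v i y >>))
  | ExtRelAlt v i j : i != j -> tnth v i = tnth v j -> ext_rel << v >>.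

Definition ext_relb : {pred {freeg (k.-tuple E) / K}} :=
  [pred x | `[< ext_rel x >]].

Fact ext_relb_zmod_closed : zmod_closed ext_relb.
Proof.
split=> [|x y]; first by apply/asboolP; exact: ExtRel0.
move=> /asboolP hx /asboolP hy; apply/asboolP.
by rewrite addrC -scaleN1r; apply: ExtRelP.
Qed.
HB.instance Definition _ :=
  GRing.isZmodClosed.Build {freeg (k.-tuple E) / K} ext_relb
    ext_relb_zmod_closed.

End MultilinearMaps.

Definition extpow (K : fieldType) (E : lmodType K) (k : nat) :=
  {ideal_quot ext_relb (E := E) (k := k)}.

Section ExteriorPower.
Variables (K : fieldType) (E : lmodType K) (k : nat).
Local Notation V := {freeg (k.-tuple E) / K}.

HB.instance Definition _ := GRing.Zmodule.on (extpow E k).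

Let proj (x : V) : extpow E k := \pi_(extpow E k) x.

Lemma extpow_eqE (x y : V) :
  (proj x = proj y) <-> ext_rel (x - y).
Proof.
split=> [/eqP|h]; last first.
  by apply/eqP; rewrite -Quotient.idealrBE; apply/asboolP.
by rewrite -Quotient.idealrBE => /asboolP.
Qed.

Definition ext_scale (a : K) (x : extpow E k) : extpow E k :=
  proj (a *: (repr x : V)).

Lemma pi_ext_scale a (x : V) : ext_scale a (proj x) = proj (a *: x).
Proof.
apply/extpow_eqE; rewrite -scalerBr -[_ *: _]addr0.
apply: ExtRelP; last exact: ExtRel0.
by apply/extpow_eqE; rewrite /proj reprK.
Qed.

Lemma proj_add (x y : V) : proj x + proj y = proj (x + y).
Proof. by rewrite /proj [RHS]raddfD. Qed.

Lemma proj_surj (x : extpow E k) : exists y : V, x = proj y.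
Proof. by exists (repr x); rewrite /proj reprK. Qed.

Fact ext_scaleA a b x : ext_scale a (ext_scale b x) = ext_scale (a * b) x.
Proof. by have [y ->] := proj_surj x; rewrite !pi_ext_scale scalerA. Qed.
Fact ext_scale1 : left_id 1 ext_scale.
Proof.
by move=> x; have [y ->] := proj_surj x; rewrite pi_ext_scale scale1r.
Qed.
Fact ext_scaleDr : right_distributive ext_scale +%R.
Proof.
move=> a x y; have [x' ->] := proj_surj x; have [y' ->] := proj_surj y.
by rewrite proj_add !pi_ext_scale scalerDr proj_add.
Qed.
Fact ext_scaleDl x : {morph ext_scale^~ x : a b / a + b}.
Proof.
move=> a b; have [y ->] := proj_surj x.
by rewrite !pi_ext_scale scalerDl proj_add.
Qed.
HB.instance Definition _ := GRing.Zmodule_isLmodule.Build K (extpow E k)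
  ext_scaleA ext_scale1 ext_scaleDr ext_scaleDl.

Definition wedge (v : k.-tuple E) : extpow E k := proj << v >>.

Lemma proj_scale a (x : V) : a *: proj x = proj (a *: x).
Proof. exact: pi_ext_scale. Qed.

Lemma wedge_multilinear : multilinear wedge.
Proof.
move=> v i a x y; rewrite /wedge proj_scale proj_add.
by apply/extpow_eqE; apply: ExtRelLinear.
Qed.

Lemma wedge_alternating : alternating wedge.
Proof.
move=> v i j ij vij; rewrite /wedge.
have -> : 0 = proj 0 by rewrite /proj raddf0.
by apply/extpow_eqE; rewrite subr0; apply: ExtRelAlt ij vij.
Qed.


Section Lift.
Variables (W : lmodType K) (f : k.-tuple E -> W).
Hypotheses (f_lin : multilinear f) (f_alt : alternating f).

Lemma fgliftD x y : fglift f (x + y) = fglift f x + fglift f y.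
Proof.
have fB := @lift_is_additive _ _ W f.
have f0 : fglift f 0 = 0 by rewrite -[0 in LHS](subrr 0) fB subrr.
by rewrite -[y in LHS]opprK fB -[- y]sub0r fB f0 sub0r opprK.
Qed.

Lemma fglift_sum (T : Type) (r : seq T) (F : T -> V) :
  fglift f (\sum_(z <- r) F z) = \sum_(z <- r) fglift f (F z).
Proof.
have f0 : fglift f 0 = 0.
  by apply: (addrI (fglift f 0)); rewrite -fgliftD !addr0.
exact: (big_morph _ fgliftD f0).
Qed.

Lemma fgliftZ a x : fglift f (a *: x) = a *: fglift f x.
Proof.
rewrite -[in RHS](freeg_sumE x) [a *: x]/(fgscale a x) /fgscale !fglift_sum.
by rewrite scaler_sumr; apply: eq_bigr => z _; rewrite !liftU scalerA.
Qed.

Lemma fglift_ext_rel x : ext_rel x -> fglift f x = 0.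
Proof.
elim=> [|a {}x y _ hx _ hy|v i a {}x y|v i j ij vij].
- by rewrite -(scale0r 0) fgliftZ scale0r.
- by rewrite fgliftD fgliftZ hx hy scaler0 addr0.
- rewrite -scaleN1r fgliftD fgliftZ fgliftD fgliftZ !liftU !scale1r f_lin.
  by rewrite scaleN1r subrr.
- by rewrite liftU scale1r (f_alt ij vij).
Qed.

Definition ext_lift (x : extpow E k) : W := fglift f (repr x : V).

Lemma ext_lift_proj x : ext_lift (proj x) = fglift f x.
Proof.
apply/eqP; rewrite -subr_eq0 -scaleN1r -fgliftZ -fgliftD scaleN1r.
by apply/eqP/fglift_ext_rel/extpow_eqE; rewrite /proj reprK.
Qed.

Fact ext_lift_linear : linear ext_lift.
Proof.
move=> a x y; have [x' ->] := proj_surj x; have [y' ->] := proj_surj y.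
by rewrite proj_scale proj_add !ext_lift_proj fgliftD fgliftZ.
Qed.

End Lift.

Lemma extpow_universal (W : lmodType K) (f : k.-tuple E -> W) :
  multilinear f -> alternating f ->
  exists g : {linear extpow E k -> W},
    (forall v, g (wedge v) = f v) /\
    (forall h : {linear extpow E k -> W},
       (forall v, h (wedge v) = f v) -> h =1 g).
Proof.
move=> f_lin f_alt.
pose g : {linear extpow E k -> W} := HB.pack (ext_lift f)
  (GRing.isLinear.Build K (extpow E k) W *:%R (ext_lift f)
     (ext_lift_linear f_lin f_alt)).
exists g.
have gE v : g (wedge v) = f v.
  by rewrite /g /= (ext_lift_proj f_lin f_alt) liftU scale1r.
clearbody g; split=> // h hE x; have [y ->] := proj_surj x.
rewrite -(freeg_sumE y).
have -> : proj (\sum_(z <- dom y) << coeff z y *g z >>)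
          = \sum_(z <- dom y) coeff z y *: wedge z.
  have proj0 : proj 0 = 0 by rewrite /proj raddf0.
  rewrite (big_morph (fun x => proj x) (fun a b => esym (proj_add a b)) proj0).
  apply: eq_bigr => z _; rewrite proj_scale; congr (proj _).
  apply/eqP/freeg_eqP => t; by rewrite coeffZ !coeffU mul1r.
rewrite (raddf_sum h) (raddf_sum g); apply: eq_bigr => z _.
have lZ (l : {linear extpow E k -> W}) a u : l (a *: u) = a *: l u.
  by rewrite linearZ.
by rewrite [LHS]lZ [RHS]lZ hE gE.
Qed.

End ExteriorPower.

Record matroid (S : finType) := Matroid {
  indep : pred {set S};
  indep0 : indep set0;
  indep_sub : forall I J : {set S}, I \subset J -> indep J -> indep I;
  indep_augment : forall I J : {set S},
    indep I -> indep J -> (#|I| < #|J|)%N ->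
    exists2 x, x \in J :\: I & indep (x |: I)
}.

Definition mbases (S : finType) (M : matroid S) : {set {set S}} :=
  [set B | maxset (indep M) B].

Section LinearMatroid.
Variables (K : fieldType) (V : lmodType K) (S : finType) (v : S -> V).
Implicit Types (I J : {set S}) (c : S -> K).

(* Independence of the family, not of its range: [v] need not be injective. *)
Definition lin_indep I : Prop :=
  forall c, \sum_(i in I) c i *: v i = 0 -> forall i, i \in I -> c i = 0.

Lemma lin_indep0 : lin_indep set0.
Proof. by move=> c _ i; rewrite inE. Qed.

Lemma lin_indep_sub I J : I \subset J -> lin_indep J -> lin_indep I.
Proof.
move=> IJ hJ c hc i iI.
pose c' j := if j \in I then c j else 0.
have /hJ /(_ i (subsetP IJ i iI)) : \sum_(j in J) c' j *: v j = 0.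
  rewrite (big_setID I) /= (setIidPr IJ) [X in _ + X]big1 ?addr0 => [|j].
    by rewrite -[RHS]hc; apply: eq_bigr => j jI; rewrite /c' jI.
  by rewrite inE /c' => /andP[/negPf -> _]; rewrite scale0r.
by rewrite /c' iI.
Qed.

Lemma lin_indep_spanned I x :
  lin_indep I -> ~ lin_indep (x |: I) ->
  exists c, v x = \sum_(i in I) c i *: v i.
Proof.
move=> hI hxI.
have xI : x \notin I.
  by apply: contra_notN hxI => xI; rewrite (setUidPr _) ?sub1set.
have [c [hc [i ixI ci]]] : exists c, \sum_(i in x |: I) c i *: v i = 0 /\
    exists2 i, i \in x |: I & c i != 0.
  apply: contrapT => h; apply: hxI => c hc i ixI; apply: contrapT => /eqP ci.
  by apply: h; exists c; split=> //; exists i.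
move: hc; rewrite big_setU1 //= => hc.
have cx : c x != 0.
  apply: contraNneq ci => cx; move: hc; rewrite cx scale0r add0r => hc.
  move: ixI; rewrite !inE => /predU1P[->|iI]; first by rewrite cx.
  by rewrite (hI _ hc).
exists (fun i => - (c x)^-1 * c i).
have := congr1 ( *:%R (c x)^-1) hc.
rewrite scalerDr scalerA mulVf // scale1r scaler0 => /eqP.
rewrite addr_eq0 => /eqP ->.
rewrite scaler_sumr -sumrN; apply: eq_bigr => j _.
by rewrite scalerA mulNr scaleNr.
Qed.

Lemma lin_indep_card I J :
  (forall x, x \in J -> exists c, v x = \sum_(i in I) c i *: v i) ->
  lin_indep J -> (#|J| <= #|I|)%N.
Proof.
move=> h hJ; rewrite leqNgt; apply/negP => IJ.
have h' x : exists c, x \in J -> v x = \sum_(i in I) c i *: v i.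
  have [/h[c hc]|_] := boolP (x \in J); first by exists c.
  by exists (fun=> 0).
pose a x := sval (cid (h' x)).
have aE x : x \in J -> v x = \sum_(i in I) a x i *: v i.
  exact: (svalP (cid (h' x))).
pose A := \matrix_(p < #|J|, q < #|I|) a (enum_val p) (enum_val q).
have : kermx A != 0.
  rewrite kermx_eq0 /row_free neq_ltn; apply/orP; left.
  exact: leq_ltn_trans (rank_leq_col _) IJ.
move=> /rowV0Pn[r /sub_kermxP rA r0].
pose c x := if insub (index x (enum J)) is Some p then r 0 p else 0.
have cE p : c (enum_val p) = r 0 p.
  rewrite /c.
  have -> : index (enum_val p) (enum J) = p.
    by rewrite (enum_val_nth (enum_val p)) index_uniq ?enum_uniq // -cardE.
  by rewrite valK.
have c0 x : x \in J -> c x = 0.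
  apply: hJ; rewrite big_enum_val /=.
  under eq_bigr => p _ do
    rewrite (aE _ (enum_valP p)) cE scaler_sumr big_enum_val.
  rewrite exchange_big big1 //= => q _.
  under eq_bigr => p _ do rewrite scalerA.
  rewrite -scaler_suml.
  have -> : \sum_p r 0 p * a (enum_val p) (enum_val q) = (r *m A) 0 q.
    by rewrite mxE; apply: eq_bigr => p _; rewrite mxE.
  by rewrite rA mxE scale0r.
case/negP: r0; apply/eqP/rowP => p.
by rewrite -cE mxE c0 // enum_valP.
Qed.

Lemma lin_indep_augment I J :
  lin_indep I -> lin_indep J -> (#|I| < #|J|)%N ->
  exists2 x, x \in J :\: I & lin_indep (x |: I).
Proof.
move=> hI hJ; rewrite ltnNge => IJ; apply: contrapT => h.
case/negP: IJ; apply: lin_indep_card hJ => x xJ.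
have [xI|xI] := boolP (x \in I).
  exists (fun i => (i == x)%:R); rewrite (bigD1 x) //= eqxx scale1r.
  by rewrite big1 ?addr0 // => i /andP[_ /negPf ->]; rewrite scale0r.
apply: lin_indep_spanned => // hxI; apply: h.
by exists x => //; rewrite inE xI.
Qed.

Definition linear_matroid : matroid S.
Proof.
apply: (@Matroid S (fun I => `[< lin_indep I >])).
- by apply/asboolP; exact: lin_indep0.
- by move=> I J IJ /asboolP hJ; apply/asboolP; exact: lin_indep_sub hJ.
- move=> I J /asboolP hI /asboolP hJ IJ.
  by have [x xJ xI] := lin_indep_augment hI hJ IJ; exists x => //; apply/asboolP.
Defined.

Lemma mbases_linearP T : T \in mbases linear_matroid ->
  lin_indep T /\ forall x, exists c, v x = \sum_(i in T) c i *: v i.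
Proof.
rewrite inE => /maxsetP[/asboolP hT maxT]; split=> // x.
have [xT|xT] := boolP (x \in T).
  exists (fun i => (i == x)%:R); rewrite (bigD1 x) //= eqxx scale1r.
  by rewrite big1 ?addr0 // => i /andP[_ /negPf ->]; rewrite scale0r.
apply: lin_indep_spanned => // hxT.
have := maxT (x |: T) (asboolT hxT) (subsetUr _ _) => xTT.
by move: xT; rewrite -xTT setU11.
Qed.

End LinearMatroid.

Section Kernel.
Variables (K : fieldType) (E : vectType K) (F : lmodType K).
Variable d : {linear E -> F}.

Lemma kernel_exists : exists Z : {vspace E}, forall x, (x \in Z) = (d x == 0).
Proof.
pose P n := `[< exists U : {vspace E},
                  (forall x, x \in U -> d x = 0) /\ \dim U = n >].
have exP : exists n, P n.
  exists 0%N; apply/asboolP; exists 0%VS; split; last exact: dimv0.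
  by move=> x; rewrite memv0 => /eqP ->; rewrite linear0.
have leP n : P n -> (n <= \dim {:E})%N.
  by move=> /asboolP[U [_ <-]]; rewrite dimvS // subvf.
case: (ex_maxnP exP leP) => n /asboolP[U [hU Un]] maxn.
exists U => x; apply/idP/eqP => [/hU //|dx].
suff: (U + <[x]>)%VS = U by move=> <-; rewrite (subvP (addvSr _ _)) ?memv_line.
apply/esym/eqP; rewrite eqEdim addvSl Un; apply: maxn; apply/asboolP.
exists (U + <[x]>)%VS; split=> // _ /memv_addP[u /hU du [_ /vlineP[a ->] ->]].
by rewrite linearD linearZ /= du dx scaler0 addr0.
Qed.

(* [F] may be infinite dimensional, so [lker] does not apply. *)
Definition kernel : {vspace E} := sval (cid kernel_exists).

Lemma mem_kernel x : (x \in kernel) = (d x == 0).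
Proof. exact: (svalP (cid kernel_exists)). Qed.

End Kernel.

Section Bases.
Variables (K : fieldType) (s : nat) (E : vectType K) (e : s.-tuple E).

Definition coordspace (J : {set 'I_s}) : {vspace E} :=
  <<[seq tnth e j | j in J]>>%VS.

(* [(f j : j in J)] in increasing order of [j], as [enum J] is increasing. *)
Definition ordered_subfamily k (f : 'I_s -> E) (J : {set 'I_s})
    (hJ : #|J| = k) : k.-tuple E :=
  tcast hJ (map_tuple f (enum_tuple J)).

Definition basis_det k (B1 B2 : k.-tuple E) : K :=
  \det (\matrix_(i < k, j < k) coord B2 i (tnth B1 j)).

Variables (he : basis_of {:E} e) (F : lmodType K) (d : {linear E -> F}).

Definition boundary_matroid : matroid 'I_s :=
  linear_matroid (fun i => d (tnth e i)).

Lemma coordspaceP (T : {set 'I_s}) x :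
  reflect (exists c : 'I_s -> K, x = \sum_(i in T) c i *: tnth e i)
          (x \in coordspace T).
Proof.
apply: (iffP idP) => [|[c ->]]; last first.
  apply: memv_suml => i iT; apply/memvZ/memv_span.
  by apply/imageP; exists i.
rewrite /coordspace span_def big_image /= => /memv_sumP[u uT ->].
have h i : exists a, i \in T -> u i = a *: tnth e i.
  have [/uT/vlineP[a ->]|_] := boolP (i \in T); first by exists a.
  by exists 0.
exists (fun i => sval (cid (h i))); apply: eq_bigr => i.
exact: (svalP (cid (h i))).
Qed.

Lemma dim_coordspace (T : {set 'I_s}) : \dim (coordspace T) = #|T|.
Proof.
have fe : free e by exact: basis_free he.
have e_inj : injective (tnth e).
  move=> i j; rewrite !(tnth_nth 0) => /eqP.
  by rewrite nth_uniq ?size_tuple ?free_uniq // => /eqP/val_inj.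
have : free [seq tnth e j | j in T].
  rewrite /image_mem (_ : map _ _ =
    [seq x <- e | x \in [seq tnth e j | j in T]]) ?filter_free //.
  rewrite -[X in filter _ X]map_tnth_enum filter_map; congr map.
  rewrite {1}/enum_mem -enumT; apply: eq_filter => i /=.
  by rewrite mem_map // mem_enum.
by move=> /eqP ->; rewrite size_map cardE.
Qed.

Lemma coordspace_kernel0 (T : {set 'I_s}) : T \in mbases boundary_matroid ->
  (coordspace T :&: kernel d = 0)%VS.
Proof.
move=> /mbases_linearP[hT _]; apply/eqP; rewrite -subv0.
apply/subvP => x /memv_capP[/coordspaceP[c ->]].
rewrite mem_kernel linear_sum /= memv0 => /eqP hc; apply/eqP.
apply: big1 => i iT; rewrite (hT c) ?scale0r //.
by rewrite -[RHS]hc; apply: eq_bigr => j _; rewrite linearZ.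
Qed.

Lemma coordspace_kernelT (T : {set 'I_s}) : T \in mbases boundary_matroid ->
  (coordspace T + kernel d = fullv)%VS.
Proof.
move=> /mbases_linearP[_ hT]; apply/eqP.
rewrite eqEsubv subvf /= -(span_basis he).
apply/span_subvP => _ /tnthP[i ->]; have [c hc] := hT i.
rewrite -[tnth e i](subrKC (\sum_(j in T) c j *: tnth e j)).
apply: memv_add; first by apply/coordspaceP; exists c.
rewrite mem_kernel linearB linear_sum /= hc subr_eq0; apply/eqP.
by apply: eq_bigr => j _; rewrite linearZ.
Qed.

Lemma card_cobase (T : {set 'I_s}) : T \in mbases boundary_matroid ->
  #|~: T| = \dim (kernel d).
Proof.
move=> hT; apply: (@addnI #|T|); rewrite cardsC card_ord -dim_coordspace.
rewrite -dimv_disjoint_sum ?coordspace_kernel0 // coordspace_kernelT //.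
by rewrite -(span_basis he) (eqP (basis_free he)) size_tuple.
Qed.

Definition kernel_proj (T : {set 'I_s}) : 'End(E) :=
  daddv_pi (kernel d) (coordspace T).

Definition kernel_basis (T : {set 'I_s}) (hT : T \in mbases boundary_matroid) :
    (\dim (kernel d)).-tuple E :=
  ordered_subfamily (fun j => kernel_proj T (tnth e j)) (card_cobase hT).

Lemma kernel_basisP (T : {set 'I_s}) (hT : T \in mbases boundary_matroid) :
  basis_of (kernel d) (kernel_basis hT).
Proof.
rewrite basisEdim size_tuple leqnn andbT; apply/subvP => x xZ.
have disj : (kernel d :&: coordspace T = 0)%VS.
  by rewrite capvC coordspace_kernel0.
have pE i : i \in T -> kernel_proj T (tnth e i) = 0.
  move=> iT; have eT : tnth e i \in coordspace T.
    by apply/memv_span/imageP; exists i.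
  have := daddv_pi_add disj (subvP (addvSr _ _) _ eT).
  rewrite (daddv_pi_id _ eT) 1?capvC // => /eqP.
  by rewrite -subr_eq0 addrK => /eqP.
have xE : x = \sum_i coord e i x *: tnth e i.
  rewrite {1}(coord_basis he (memvf x)).
  by apply: eq_bigr => i _; rewrite (tnth_nth 0).
rewrite -(daddv_pi_id disj xZ) {1}xE linear_sum /=.
apply: memv_suml => i _; rewrite linearZ /=; apply: memvZ.
have [/pE -> |iT] := boolP (i \in T); first exact: mem0v.
apply: memv_span; rewrite /kernel_basis /ordered_subfamily val_tcast /=.
by apply/mapP; exists i; rewrite ?mem_enum ?inE.
Qed.

Definition ext_monomial k (J : {set 'I_s}) (hJ : #|J| = k) : extpow E k :=
  wedge (ordered_subfamily (tnth e) hJ).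

End Bases.

(* Main.v *)
(* Expanding [det Z] in the basis [e] gives, as in the Cauchy-Binet formula, the
   sum over all [J] of size [dim Z] of the minor of [J] times [e_J].  Let [T] be
   the complement of [J].  If [T] is a basis of the matroid, [Z_T] kills [e_i]
   for [i] in [T] and fixes [Z], so that the coordinates of an element of [Z] in
   the basis [(Z_T (e_j) : j in J)] are its coordinates in [e] with index in [J]:
   the minor is [det (Z / Z_T)].  Otherwise [E_T] meets [Z] nontrivially, and the
   minor vanishes. *)
Require Import Defs.
From HB Require Import structures.
From mathcomp Require Import all_boot all_order all_algebra.
From mathcomp Require Import perm boolp reals.

Set Implicit Arguments.
Unset Strict Implicit.
Unset Printing Implicit Defensive.

Import GRing.Theory.
Local Open Scope ring_scope.

(** * Replacing one entry of a tuple *)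

Section Tupdate.
Variables (K : fieldType) (E : lmodType K).

Lemma tnth_tupdate k (v : k.-tuple E) i x j :
  tnth (tupdate v i x) j = if j == i then x else tnth v j.
Proof. by rewrite tnth_mktuple. Qed.

Lemma tupdate_id k (v : k.-tuple E) i : tupdate v i (tnth v i) = v.
Proof.
by apply: eq_from_tnth => j; rewrite tnth_tupdate; case: eqP => // ->.
Qed.

Lemma tupdate_comm k (v : k.-tuple E) i j x y : i != j ->
  tupdate (tupdate v i x) j y = tupdate (tupdate v j y) i x.
Proof.
move=> ij; apply: eq_from_tnth => l; rewrite !tnth_tupdate.
by case: (eqVneq l j) => // ->; rewrite eq_sym (negPf ij).
Qed.

Lemma tupdate_cons0 k x y (v : k.-tuple E) :
  tupdate [tuple of x :: v] ord0 y = [tuple of y :: v].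
Proof.
apply: eq_from_tnth => j; rewrite tnth_tupdate.
by case: (unliftP ord0 j) => [l|] ->; rewrite ?tnthS ?tnth0.
Qed.

Lemma tupdate_consS k x y (v : k.-tuple E) i :
  tupdate [tuple of x :: v] (lift ord0 i) y = [tuple of x :: tupdate v i y].
Proof.
apply: eq_from_tnth => j; rewrite tnth_tupdate.
by case: (unliftP ord0 j) => [l|] ->; rewrite ?tnthS ?tnth0 ?tnth_tupdate.
Qed.

End Tupdate.

(** * Expansion of multilinear and alternating maps *)

Section Multilinear.
Variables (K : fieldType) (E W : lmodType K).

Lemma multilinearD k (f : k.-tuple E -> W) v i x y : multilinear f ->
  f (tupdate v i (x + y)) = f (tupdate v i x) + f (tupdate v i y).
Proof. by move=> f_lin; rewrite -{1}[x]scale1r f_lin scale1r. Qed.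

Lemma multilinear_sum k (f : k.-tuple E -> W) (J : finType) v i
    (c : J -> K) (u : J -> E) : multilinear f ->
  f (tupdate v i (\sum_j c j *: u j)) = \sum_j c j *: f (tupdate v i (u j)).
Proof.
move=> f_lin; apply: (big_rec2 (fun x y => f (tupdate v i x) = y)).
  (* Empty sum: linearity with scalar [-1] at [0], [0] forces the value at [0] to vanish. *)
  have := f_lin v i (-1) 0 0.
  by rewrite scaler0 addr0 scaleN1r addNr.
by move=> j x y _ <-; rewrite f_lin.
Qed.

Lemma multilinear_cons k (f : k.+1.-tuple E -> W) x : multilinear f ->
  multilinear (fun v : k.-tuple E => f [tuple of x :: v]).
Proof. by move=> f_lin v i a y y'; rewrite -!tupdate_consS f_lin. Qed.

(** Induction on [k]: the first argument is expanded by linearity, and the induction hypothesis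
    applies to [f] with that argument frozen at [u j]. *)
Lemma multilinear_expand (J : finType) (u : J -> E) k (f : k.-tuple E -> W)
    (A : 'I_k -> J -> K) : multilinear f ->
  f [tuple \sum_j A i j *: u j | i < k] =
    \sum_(t : k.-tuple J) (\prod_i A i (tnth t i)) *: f (map_tuple u t).
Proof.
elim: k f A => [|k IH] f A f_lin.
  rewrite (big_pred1 [tuple]) => [|t]; last exact/esym/eqP/tuple0.
  by rewrite big_ord0 scale1r; congr f; rewrite [LHS]tuple0 [RHS]tuple0.
(* The head [0] is a placeholder, overwritten by the update at [ord0]. *)
have -> : [tuple \sum_j A i j *: u j | i < k.+1] =
    tupdate [tuple of 0 :: [tuple \sum_j A (lift ord0 i) j *: u j | i < k]]
      ord0 (\sum_j A ord0 j *: u j).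
  rewrite tupdate_cons0; apply: eq_from_tnth => j.
  by case: (unliftP ord0 j) => [l|] ->; rewrite ?tnthS ?tnth0 !tnth_mktuple.
rewrite multilinear_sum //.
under eq_bigr => j _ do
  rewrite tupdate_cons0 (IH _ _ (multilinear_cons _ f_lin)) scaler_sumr.
rewrite pair_big /=.
rewrite [RHS](reindex (fun p : J * k.-tuple J => [tuple of p.1 :: p.2])).
  apply: eq_bigr => -[j t] _ /=; rewrite scalerA big_ord_recl tnth0.
  congr (_ * _ *: f _); last exact: val_inj.
  by apply: eq_bigr => i _; rewrite tnthS.
exists (fun t => (thead t, [tuple of behead t])) => [[j t] _|t _] /=.
  by congr pair; apply: val_inj.
by rewrite -tuple_eta.
Qed.

(** Polarization: with [g x y] the value of [f] when [x], [y] stand at places [i], [j], expanding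
    [g (x + y) (x + y) = 0] leaves [g x y + g y x = 0]. *)
Lemma alternating_tperm k (f : k.-tuple E -> W) (v : k.-tuple E) i j :
  multilinear f -> alternating f -> i != j ->
  f [tuple tnth v (tperm i j l) | l < k] = - f v.
Proof.
move=> f_lin f_alt ij; pose g x y := f (tupdate (tupdate v i x) j y).
have g0 x : g x x = 0.
  by apply: (f_alt _ i j ij); rewrite !tnth_tupdate eqxx (negPf ij) eqxx.
have gDr x y y' : g x (y + y') = g x y + g x y' by exact: multilinearD.
have gDl x x' y : g (x + x') y = g x y + g x' y.
  by rewrite /g !(tupdate_comm _ _ _ ij) multilinearD.
have -> : f v = g (tnth v i) (tnth v j).
  by rewrite /g tupdate_comm // !tupdate_id.
have -> : [tuple tnth v (tperm i j l) | l < k] =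
    tupdate (tupdate v i (tnth v j)) j (tnth v i).
  apply: eq_from_tnth => l; rewrite !tnth_tupdate tnth_mktuple.
  by case: tpermP => [->|->|/eqP/negPf-> /eqP/negPf->] //;
    rewrite ?eqxx // (negPf ij).
apply/eqP; rewrite -addr_eq0 -/(g _ _).
have := g0 (tnth v i + tnth v j).
by rewrite gDl !gDr !g0 add0r addr0 addrC => ->.
Qed.

(** Write [p] as a product of transpositions; each contributes a factor [-1]. *)
Lemma alternating_perm k (f : k.-tuple E -> W) (v : k.-tuple E) (p : 'S_k) :
  multilinear f -> alternating f ->
  f [tuple tnth v (p i) | i < k] = (-1) ^+ p *: f v.
Proof.
move=> f_lin f_alt; have [ts -> {p}] := prod_tpermP p.
elim: ts v => [|t ts IH] v /=.
  move=> _; rewrite big_nil odd_perm1 expr0 scale1r; congr f.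
  by apply: eq_from_tnth => i; rewrite tnth_mktuple perm1.
case/andP=> t12 hts; rewrite big_cons odd_mul_tperm t12 signr_addb expr1 mulN1r.
set q := (\prod_(_ <- _) _)%g in IH *.
(* In a product of permutations the left factor acts first, so the transposition permutes the places
   of the tuple already rearranged by [q]. *)
have -> : [tuple tnth v ((tperm t.1 t.2 * q)%g i) | i < k] =
    [tuple tnth [tuple tnth v (q i) | i < k] (tperm t.1 t.2 i) | i < k].
  by apply: eq_from_tnth => i; rewrite !tnth_mktuple permM.
by rewrite alternating_tperm // IH // scaleNr.
Qed.

(** As [o] has no repetition, its rearrangements correspond bijectively to permutations. Sorting the
    arguments back costs a sign, and the coefficients add up to the Leibniz formula. *)
Lemma alternating_perm_sum (J : finType) (u : J -> E) k (f : k.-tuple E -> W)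
    (A : 'I_k -> J -> K) (o : k.-tuple J) :
  multilinear f -> alternating f -> uniq o ->
  \sum_(t : k.-tuple J | perm_eq t o)
      (\prod_i A i (tnth t i)) *: f (map_tuple u t) =
    \det (\matrix_(i, j) A i (tnth o j)) *: f (map_tuple u o).
Proof.
move=> f_lin f_alt /tuple_uniqP o_inj.
pose h (p : 'S_k) := [tuple tnth o (p i) | i < k].
have h_inj : injective h.
  move=> p q /(congr1 (@tnth _ _)) pq; apply/permP => i; apply: o_inj.
  by have := congr1 (@^~ i) pq; rewrite !tnth_mktuple.
rewrite (eq_bigl (mem (h @: [set: 'S_k]))) => [|t /=]; last first.
  apply/tuple_permP/imsetP => [[p tp]|[p _ ->]]; last by exists p.
  by exists p; [rewrite inE | exact: val_inj].
rewrite big_imset /=; last by move=> p q _ _ /h_inj.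
rewrite /determinant scaler_suml; apply: eq_big => [p|p _].
  by rewrite inE.
have -> : map_tuple u (h p) = [tuple tnth (map_tuple u o) (p i) | i < k].
  by apply: eq_from_tnth => i; rewrite !tnth_mktuple !tnth_map !tnth_ord_tuple.
rewrite alternating_perm // scalerA mulrC; congr (_ * _ *: _).
by apply: eq_bigr => i _; rewrite tnth_mktuple mxE.
Qed.

(** Terms with a repeated index vanish since [f] is alternating; the others are grouped by their set
    of indices. *)
Lemma alternating_expand (J : finType) (u : J -> E) k (f : k.-tuple E -> W)
    (A : 'I_k -> J -> K) : multilinear f -> alternating f ->
  f [tuple \sum_j A i j *: u j | i < k] =
    \sum_(I : {set J}) \sum_(t : k.-tuple J | uniq t && ([set i in t] == I))
       (\prod_i A i (tnth t i)) *: f (map_tuple u t).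
Proof.
move=> f_lin f_alt; rewrite multilinear_expand //.
rewrite (bigID (fun t : k.-tuple J => uniq t)) /= addrC big1 ?add0r.
  by rewrite (partition_big (fun t : k.-tuple J => [set i in t]) xpredT).
move=> t /tuple_uniqP t_inj; have [i [j [ij tij]]] : exists i j,
    i != j /\ tnth t i = tnth t j.
  apply: contrapT => h; apply: t_inj => i j tij; apply/eqP.
  by apply: contrapT => /negP ij; apply: h; exists i, j.
by rewrite (f_alt _ i j ij) ?scaler0 // !tnth_map tij.
Qed.

End Multilinear.

(** * Minors of a basis of the kernel, and bases of the matroid *)

Section KernelMinors.
Variables (K : fieldType) (s : nat) (E : vectType K) (e : s.-tuple E).
Variables (he : basis_of {:E} e) (F : lmodType K) (d : {linear E -> F}).
Implicit Types J T : {set 'I_s}.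

(** Keeps the indices themselves, in the order of [ordered_subfamily], so that they can label the
    columns of a minor. *)
Definition ordered_elems k J (hJ : #|J| = k) : k.-tuple 'I_s :=
  tcast hJ (enum_tuple J).

Lemma val_ordered_elems k J (hJ : #|J| = k) :
  ordered_elems hJ = enum J :> seq _.
Proof. by rewrite val_tcast. Qed.

Lemma ordered_subfamilyE k (f : 'I_s -> E) J (hJ : #|J| = k) :
  ordered_subfamily f hJ = map_tuple f (ordered_elems hJ).
Proof. by apply: val_inj; rewrite /= val_ordered_elems val_tcast. Qed.

(** Matches the inner range of [alternating_expand] with the range of [alternating_perm_sum]. *)
Lemma perm_ordered_elems k J (hJ : #|J| = k) (t : k.-tuple 'I_s) :
  perm_eq t (ordered_elems hJ) = uniq t && ([set i in t] == J).
Proof.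
rewrite val_ordered_elems; apply/idP/andP => [tJ|[t_uniq /eqP <-]].
  rewrite (perm_uniq tJ) enum_uniq; split=> //; apply/eqP/setP => i.
  by rewrite inE (perm_mem tJ) mem_enum.
by apply: uniq_perm; rewrite ?enum_uniq // => i; rewrite mem_enum inE.
Qed.

Lemma coord_sumE x : x = \sum_j coord e j x *: tnth e j.
Proof.
rewrite {1}(coord_basis he (memvf x)).
by apply: eq_bigr => j _; rewrite (tnth_nth 0).
Qed.

Lemma coord_coordspace0 T x j : x \in coordspace e T -> j \notin T ->
  coord e j x = 0.
Proof.
move=> /coordspaceP[c ->] jT; rewrite linear_sum big1 // => i iT.
rewrite linearZ /= (tnth_nth 0) coord_free ?(basis_free he) //.
by case: eqP => [ij|]; rewrite ?mulr0 //; rewrite -ij iT in jT.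
Qed.

(** Relations among the images of the [e_i], for [i] in [T], are the elements of the coordinate
    space lying in the kernel; freeness of [e] recovers the coefficients. *)
Lemma lin_indep_coordspace T :
  lin_indep (fun i => d (tnth e i)) T <->
  (coordspace e T :&: kernel d = 0)%VS.
Proof.
split=> [hT|hT c hc i iT].
  apply/eqP; rewrite -subv0; apply/subvP => x /memv_capP[/coordspaceP[c ->]].
  rewrite mem_kernel linear_sum /= memv0 => /eqP hc; apply/eqP.
  apply: big1 => i iT; rewrite (hT c) ?scale0r //.
  by rewrite -[RHS]hc; apply: eq_bigr => j _; rewrite linearZ.
have : \sum_(j in T) c j *: tnth e j \in (coordspace e T :&: kernel d)%VS.
  apply/memv_capP; split; first by apply/coordspaceP; exists c.
  rewrite mem_kernel linear_sum /=; apply/eqP; rewrite -[RHS]hc.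
  by apply: eq_bigr => j _; rewrite linearZ.
rewrite hT memv0 => /eqP /(congr1 (coord e i)); rewrite linear0 => <-.
(* Extension by zero to all indices, the form that [coord_sum_free] requires. *)
pose c' j := if j \in T then c j else 0.
have := coord_sum_free c' i (basis_free he); rewrite {2}/c' iT => <-.
congr (coord e i _); rewrite [RHS]big_mkcond; apply: eq_bigr => j _.
by rewrite (tnth_nth 0) /c'; case: ifP; rewrite ?scale0r.
Qed.

(** Dimension count: an independent [B] satisfies [#|B| + \dim (kernel d) <= s], and [T] attains
    equality, hence is maximal. *)
Lemma mbases_coordspace T : #|~: T| = \dim (kernel d) ->
  (coordspace e T :&: kernel d = 0)%VS -> T \in mbases (boundary_matroid e d).
Proof.
move=> cT /lin_indep_coordspace hT; rewrite inE; apply/maxsetP.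
split=> [|B /asboolP /lin_indep_coordspace hB TB]; first exact/asboolP.
apply/esym/eqP; rewrite eqEcard TB /=.
rewrite -(leq_add2r (\dim (kernel d))) -{2}cT cardsC card_ord.
rewrite -(dim_coordspace he B) -dimv_disjoint_sum //.
by rewrite (leq_trans (dimvS (subvf _))) // (size_basis he).
Qed.

Lemma minor_neq0_mbases (z : (\dim (kernel d)).-tuple E) T
    (hT : #|~: T| = \dim (kernel d)) : basis_of (kernel d) z ->
  \det (\matrix_(i, j) coord e (tnth (ordered_elems hT) j) (tnth z i)) != 0 ->
  T \in mbases (boundary_matroid e d).
Proof.
move=> hz det_neq0; apply: mbases_coordspace => //.
apply/eqP; rewrite -subv0; apply/subvP => x /memv_capP[xT xZ].
set M := (\matrix_(_, _) _) in det_neq0.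
(* [r *m M] lists the coordinates of [x] in [e] outside [T], all zero because [x] lies in the
   coordinate space of [T]. Invertibility of [M] then gives [x = 0]. *)
pose r := \row_i coord z i x.
have rM : r *m M = 0.
  apply/rowP => j; rewrite !mxE.
  rewrite -[RHS](coord_coordspace0 (j := tnth (ordered_elems hT) j) xT).
    rewrite {1}(coord_basis hz xZ) linear_sum; apply: eq_bigr => i _.
    by rewrite !mxE linearZ (tnth_nth 0 z).
  by rewrite -in_setC -mem_enum -(val_ordered_elems hT) mem_tnth.
have r0 : r = 0.
  apply/eqP; apply: contraNT det_neq0 => r_neq0.
  by apply/det0P; exists r.
rewrite memv0 (coord_basis hz xZ) big1 // => i _.
by have := congr1 (fun r : 'rV_ _ => r 0 i) r0; rewrite !mxE => ->; rewrite scale0r.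
Qed.

Lemma kernel_proj0 T i : T \in mbases (boundary_matroid e d) -> i \in T ->
  kernel_proj e d T (tnth e i) = 0.
Proof.
move=> hT iT; have disj := coordspace_kernel0 hT.
have eT : tnth e i \in coordspace e T by apply/memv_span/imageP; exists i.
(* The vector is the sum of its two components and equals the one along [coordspace e T], so the
   other is zero. *)
have := @daddv_pi_add _ _ (kernel d) (coordspace e T) (tnth e i).
rewrite capvC (subvP (addvSr _ _)) // => /(_ disj isT).
by rewrite (daddv_pi_id disj eT) => /eqP; rewrite -subr_eq0 addrK => /eqP.
Qed.

Lemma coord_kernel_basis T (hT : T \in mbases (boundary_matroid e d)) x j :
  x \in kernel d ->
  coord (kernel_basis he hT) j x =
    coord e (tnth (ordered_elems (card_cobase he hT)) j) x.
Proof.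
move=> xZ; set o := ordered_elems _.
have disj : (kernel d :&: coordspace e T = 0)%VS.
  by rewrite capvC coordspace_kernel0.
have xE : x = \sum_j coord e (tnth o j) x *: (kernel_basis he hT)`_j.
  rewrite -{1}(daddv_pi_id disj xZ) {1}[x]coord_sumE linear_sum.
  rewrite (bigID (mem T)) /= big1 ?add0r => [|i iT]; last first.
    by rewrite linearZ /= -/(kernel_proj e d T) kernel_proj0 ?scaler0.
  (* Summing along the ordered list [o] turns indices outside [T] into positions in
     [kernel_basis]. *)
  transitivity (\sum_(i <- o) coord e i x *: kernel_proj e d T (tnth e i)).
    rewrite val_ordered_elems big_enum; apply: eq_big => [i|i _].
      by rewrite inE.
    by rewrite linearZ.
  rewrite big_tuple; apply: eq_bigr => i _.
  by rewrite /kernel_basis ordered_subfamilyE -tnth_nth tnth_map.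
by rewrite {1}xE coord_sum_free // (basis_free (kernel_basisP he hT)).
Qed.

Lemma basis_det_kernel_basis (z : (\dim (kernel d)).-tuple E) T
    (hT : T \in mbases (boundary_matroid e d)) : basis_of (kernel d) z ->
  basis_det z (kernel_basis he hT) =
  \det (\matrix_(i, j)
    coord e (tnth (ordered_elems (card_cobase he hT)) j) (tnth z i)).
Proof.
(* [basis_det] has the vectors of [z] as columns, the minor has them as rows. *)
move=> hz; rewrite /basis_det -det_tr; congr (\det _); apply/matrixP => i j.
by rewrite !mxE coord_kernel_basis // (basis_mem hz) // mem_tnth.
Qed.

End KernelMinors.

Theorem proposition13p1 (R : realType) (K : fieldType)
    (hK : real_or_complex R K)
    (s : nat) (E : vectType K) (e : s.-tuple E) (he : basis_of {:E} e)
    (F : lmodType K) (d : {linear E -> F})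
    (z : (\dim (kernel d)).-tuple E) (hz : basis_of (kernel d) z) :
  wedge z =
    \sum_(T : {T | T \in mbases (boundary_matroid e d)})
       basis_det z (kernel_basis he (valP T))
         *: ext_monomial e (card_cobase he (valP T)).
Proof.
pose A i j : K := coord e j (tnth z i).
have w_lin := @wedge_multilinear K E (\dim (kernel d)).
have w_alt := @wedge_alternating K E (\dim (kernel d)).
have {1}-> : z = [tuple \sum_j A i j *: tnth e j | i < \dim (kernel d)].
  by apply: eq_from_tnth => i; rewrite tnth_mktuple -(coord_sumE he).
(* The index sets of the expansion are renamed as complements [~: T]. *)
rewrite alternating_expand // (reindex_inj (@setC_inj _)) /=.
pose G (T : {set 'I_s}) :=
  \sum_(t : (\dim (kernel d)).-tuple 'I_s | uniq t && ([set i in t] == ~: T))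
     (\prod_i A i (tnth t i)) *: wedge (map_tuple (tnth e) t).
(* Assumes only the size of the complement, so as to serve bases and non-bases alike. *)
have GE T (hT : #|~: T| = \dim (kernel d)) :
    G T = \det (\matrix_(i, j) A i (tnth (ordered_elems hT) j))
            *: ext_monomial e hT.
  rewrite /G /ext_monomial ordered_subfamilyE -alternating_perm_sum //.
    by apply: eq_bigl => t; rewrite perm_ordered_elems.
  by rewrite val_ordered_elems enum_uniq.
rewrite -/(\sum_T G T) (bigID (mem (mbases (boundary_matroid e d)))) /=.
rewrite [X in _ + X]big1 ?addr0 => [|T /negP hT].
  rewrite big_sub; apply: eq_bigr => T _.
  by rewrite (GE _ (card_cobase he (valP T))) basis_det_kernel_basis.
(* For a non-basis [T], either the complement has the right size and the minor vanishes, or no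
   repetition-free tuple has [~: T] as its set of entries and the sum is empty. *)
have [cT|cT] := eqVneq #|~: T| (\dim (kernel d)).
  rewrite (GE _ cT); apply/eqP; rewrite scaler_eq0.
  apply: contra_notT hT => /norP[det_neq0 _].
  exact: minor_neq0_mbases hz det_neq0.
apply: big1 => t /andP[t_uniq /eqP tT]; case/eqP: cT.
by rewrite -tT cardsE (card_uniqP t_uniq) size_tuple.
Qed.
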